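(* Let $(D,+,-,0,\sigma,\circ,\cdot)$ be a left ditruss and suppose that $\sigma$ is an idempotent group endomorphism of the additive group $(D,+)$, that $\circ$ is associative, and that $\cdot$ is left distributive. Then: (a) The mapping $\lambda^D\colon (D,\circ)\to \operatorname{End}_{\mathsf{Gp}}(D,+)$, defined by $\lambda^D\colon a\mapsto\lambda^D_a$, is a semigroup morphism. That is, $(a\circ b)\cdot c=a\cdot(b\cdot c)$ for every $a,b,c\in D$. (b) The group endomorphism $\lambda^D_0$ of the group $(D,+,-,0)$ is an idempotent group endomorphism.
   Context: A left ditruss is an algebra $(D,+,-,0,\sigma,\circ,\cdot)$, where $+,\circ,\cdot$ are binary operations, $-$ and $\sigma$ are unary and $0$ is nullary, such that $(D,+,-,0)$ is a (not necessarily abelian) group and $\sigma(a)+a\cdot b=a\circ b$ for all $a,b\in D$. The operation $\cdot$ is left distributive if $a\cdot(b+c)=a\cdot b+a\cdot c$ for all $a,b,c\in D$. For $a\in D$, the mapping $\lambda^D_a\colon D\to D$ is defined by $\lambda^D_a(b)=a\cdot b$ for every $b\in D$. $\operatorname{End}_{\mathsf{Gp}}(D,+)$ is the semigroup, under composition, of all group endomorphisms of $(D,+)$. *)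

(* Defs.v *)
From HB Require Import structures.
From mathcomp Require Import all_boot.
From mathcomp Require Import boolp.

Set Implicit Arguments.
Unset Strict Implicit.
Unset Printing Implicit Defensive.

Import Algebra.

Local Open Scope ring_scope.

(* Groups written additively, not necessarily abelian: MathComp's zmodType is
   abelian, and its groupType is written multiplicatively. baseZmodType carries
   the operations +, 0, - and no axiom. *)
HB.mixin Record BaseZmodule_isAddGroup D of BaseZmodule D := {
  addgA : associative (+%R : D -> D -> D);
  add0g : left_id (0 : D) +%R;
  addg0 : right_id (0 : D) +%R;
  addNg : left_inverse (0 : D) -%R +%R;
  addgN : right_inverse (0 : D) -%R +%R
}.

#[short(type="addGroupType")]
HB.structure Definition AddGroup :=
  {D of BaseZmodule_isAddGroup D & BaseZmodule D}.

HB.mixin Record AddGroup_isLeftDitruss D of AddGroup D := {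
  sigma : D -> D;
  circ : D -> D -> D;
  dot : D -> D -> D;
  sigmaD_dot : forall a b : D, sigma a + dot a b = circ a b
}.

#[short(type="leftDitrussType")]
HB.structure Definition LeftDitruss :=
  {D of AddGroup_isLeftDitruss D & AddGroup D}.

Declare Scope ditruss_scope.
Delimit Scope ditruss_scope with ditruss.

Notation "a ∘ b" := (circ a b) (at level 40, left associativity) : ditruss_scope.
Notation "a ⋅ b" := (dot a b) (at level 40, left associativity) : ditruss_scope.

(* {additive D -> D} requires preservation of 0 and + only, and assumes
   no commutativity. *)
Definition End_Gp (D : addGroupType) : Type := {additive D -> D}.

Section EndGp.
Variable D : addGroupType.
Implicit Types f g h : {additive D -> D}.

Fact comp_nmod_morphism f g : nmod_morphism (f \o g).
Proof. by split=> [|x y] /=; rewrite ?raddf0 ?raddfD. Qed.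

Definition End_comp f g : End_Gp D :=
  HB.pack_for {additive D -> D} (f \o g)
    (isNmodMorphism.Build D D (f \o g) (comp_nmod_morphism f g)).

Lemma End_compE f g : End_comp f g = f \o g :> (D -> D).
Proof. by []. Qed.

Lemma End_Gp_inj f g : f = g :> (D -> D) -> f = g.
Proof.
case: f g => [f [[fP]]] [g [[gP]]] /= efg.
by subst g; rewrite (Prop_irrelevance fP gP).
Qed.

HB.instance Definition _ := hasMul.Build (End_Gp D) End_comp.

Lemma End_GpA : associative (@mul (End_Gp D)).
Proof. by move=> f g h; apply: End_Gp_inj. Qed.

End EndGp.

(* (D, ∘); associativity of ∘ is not part of the definition of a ditruss, so
   this is only a magma in general. For semigroups,
   {multiplicative S -> T} is the type of semigroup morphisms. *)
Definition circ_magma (D : leftDitrussType) : Type := D.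

HB.instance Definition _ (D : leftDitrussType) :=
  hasMul.Build (circ_magma D) (@circ D).

Definition lambda (D : leftDitrussType) (a : D) : D -> D := fun b => dot a b.

(* Main.v *)
From HB Require Import structures.
Require Import Defs.
From mathcomp Require Import all_boot.
From mathcomp Require boolp.

Import Algebra.

(** Setting c = 0 in the associativity of ∘ is the key. Left distributivity makes
    every a ⋅ 0 vanish, so a ∘ 0 = σ a, and (a ∘ b) ∘ 0 = a ∘ (b ∘ 0) becomes
    σ (a ∘ b) = a ∘ σ b (lemma [sigma_circ]). For arbitrary c, the two sides of
    the associativity law then expand to
      (a ∘ b) ∘ c = σ (a ∘ b) + (a ∘ b) ⋅ c,
      a ∘ (b ∘ c) = (σ a + a ⋅ σ b) + a ⋅ (b ⋅ c) = a ∘ σ b + a ⋅ (b ⋅ c),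
    and cancelling the equal left summands gives (a ∘ b) ⋅ c = a ⋅ (b ⋅ c).
    Since σ 0 = 0 yields 0 ∘ 0 = 0, the case a = b = 0 of this law says that
    lambda 0 is idempotent. *)

Local Open Scope ring_scope.
Local Open Scope ditruss_scope.

Lemma addg_cancel_l (D : addGroupType) (x : D) : injective (+%R x).
Proof. by move=> y z exyz; rewrite -[y]add0g -(addNg x) -addgA exyz addgA addNg add0g. Qed.

Lemma lambda_nmod_morphism (D : leftDitrussType) (a : D)
    (dot_left_distr : forall b c : D, a ⋅ (b + c) = a ⋅ b + a ⋅ c) :
  nmod_morphism (lambda a).
Proof.
split=> [|b c]; last exact: dot_left_distr.
(* The value at 0 is an additive idempotent, and cancellation kills it. *)
by apply: (@addg_cancel_l _ (a ⋅ 0)); rewrite -dot_left_distr !addg0.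
Qed.

Section LeftDistributive.

Variable D : leftDitrussType.
Hypothesis circ_assoc : associative (@circ D).
Hypothesis dot_left_distr : forall a b c : D, a ⋅ (b + c) = a ⋅ b + a ⋅ c.

Lemma circ0 (a : D) : a ∘ 0 = sigma a.
Proof.
have [a0 _] := lambda_nmod_morphism _ _ (dot_left_distr a).
by rewrite -sigmaD_dot -/(lambda a 0) a0 addg0.
Qed.

(** Associativity at (a, b, 0), since x ∘ 0 = σ x. *)
Lemma sigma_circ (a b : D) : sigma (a ∘ b) = a ∘ sigma b.
Proof. by rewrite -!circ0 circ_assoc. Qed.

Lemma dot_circ (a b c : D) : (a ∘ b) ⋅ c = a ⋅ (b ⋅ c).
Proof.
apply: (@addg_cancel_l _ (sigma (a ∘ b))).
rewrite sigmaD_dot -circ_assoc -[b ∘ c]sigmaD_dot -sigmaD_dot dot_left_distr.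
by rewrite addgA sigmaD_dot sigma_circ.
Qed.

Definition lambda_End (a : circ_magma D) : End_Gp D :=
  HB.pack_for {additive D -> D} (lambda (a : D))
    (isNmodMorphism.Build D D (lambda (a : D))
      (lambda_nmod_morphism _ _ (dot_left_distr a))).

Lemma lambda_EndM : {morph lambda_End : a b / (a * b)%g >-> (a * b)%g}.
Proof. by move=> a b; apply: End_Gp_inj; apply: boolp.funext => c; apply: dot_circ. Qed.

End LeftDistributive.

Theorem proposition3p7 (D : leftDitrussType)
  (sigma_morph : nmod_morphism (@sigma D))
  (sigma_idem : idempotent_fun (@sigma D))
  (circ_assoc : associative (@circ D))
  (dot_left_distr : forall a b c : D, a ⋅ (b + c) = a ⋅ b + a ⋅ c) :
  ((exists Lambda : {multiplicative circ_magma D -> End_Gp D},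
      forall a : D, Lambda a = lambda a :> (D -> D)) /\
   (forall a b c : D, (a ∘ b) ⋅ c = a ⋅ (b ⋅ c))) /\
  (nmod_morphism (lambda (0 : D)) /\ idempotent_fun (lambda (0 : D))).
Proof.
have dotA := dot_circ _ circ_assoc dot_left_distr.
split; split=> //.
- pose Lambda : {multiplicative circ_magma D -> End_Gp D} :=
    HB.pack_for {multiplicative circ_magma D -> End_Gp D}
      (lambda_End _ dot_left_distr)
      (isMultiplicative.Build (circ_magma D) (End_Gp D)
        (lambda_End _ dot_left_distr)
        (lambda_EndM _ circ_assoc dot_left_distr)).
  by exists Lambda.
- exact: lambda_nmod_morphism (dot_left_distr 0).
- move=> c /=; rewrite /lambda -dotA circ0 //.
  by case: sigma_morph => ->.
Qed.
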